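(* Let $R$ be an NP-ring that is a ZN-ring. Then an $R$-module $M$ is $\phi$-$w$-flat if and only if it is strongly $\phi$-$w$-flat.
   Context: All rings are commutative with $1\neq 0$ and all modules are unitary. $\mathrm{Nil}(R)$ is the nilradical of $R$ and $\mathrm{Z}(R)$ the set of all zero-divisors of $R$. $R$ is an NP-ring if $\mathrm{Nil}(R)$ is a prime ideal, and a ZN-ring if $\mathrm{Z}(R)=\mathrm{Nil}(R)$. An ideal is nonnil if it contains a non-nilpotent element. Over an NP-ring $R$, an $R$-module $T$ is $\phi$-torsion if for every $x\in T$ there is a nonnil ideal $I$ of $R$ with $Ix=0$. A GV-ideal of $R$ is a finitely generated ideal $J$ such that the natural homomorphism $R\to \operatorname{Hom}_R(J,R)$, $r\mapsto (x\mapsto rx)$, is an isomorphism. A module $M$ is GV-torsion if for every $x\in M$ there is a GV-ideal $J$ with $Jx=0$. Over an NP-ring $R$: an $R$-module $M$ is $\phi$-$w$-flat if $\operatorname{Tor}_1^R(T,M)$ is GV-torsion for every $\phi$-torsion $R$-module $T$; $M$ is strongly $\phi$-$w$-flat if $\operatorname{Tor}_n^R(T,M)$ is GV-torsion for every $\phi$-torsion $R$-module $T$ and every $n\ge 1$. *)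

(* Defs.v *)
From HB Require Import structures.
From mathcomp Require Import all_boot all_algebra.
From mathcomp Require Import finmap.
From mathcomp.multinomials Require Import xfinmap monalg.
From mathcomp Require Import boolp.

Set Implicit Arguments.
Unset Strict Implicit.
Unset Printing Implicit Defensive.

Import GRing.Theory.

Local Open Scope ring_scope.
Local Open Scope quotient_scope.

(* Boolean predicates are used for subsets: classically, every P : V -> Prop  *)
(* is one, as [pred x | `[< P x >]].                                          *)

Record submodule (R : comNzRingType) (V : lmodType R) (S : submodClosed V) :=
  Submodule { submodule_val : V; _ : submodule_val \in S }.

HB.instance Definition _ (R : comNzRingType) (V : lmodType R)
    (S : submodClosed V) := [isSub of submodule S for @submodule_val R V S].
HB.instance Definition _ (R : comNzRingType) (V : lmodType R)
    (S : submodClosed V) := [Choice of submodule S by <:].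
HB.instance Definition _ (R : comNzRingType) (V : lmodType R)
    (S : submodClosed V) := [SubChoice_isSubLmodule of submodule S by <:].

(* Over a ring, a submodClosed predicate is also closed under opposites, but  *)
(* the library does not infer zmodClosed from submodClosed.                   *)
Definition zmod_of_submod (R : comNzRingType) (V : lmodType R)
  (S : submodClosed V) : {pred V} := [pred x | x \in S].

Fact zmod_of_submod_closed (R : comNzRingType) (V : lmodType R)
  (S : submodClosed V) : zmod_closed (zmod_of_submod S).
Proof.
by have [S0 SB] := GRing.submod_closedB (submodClosedP S); split.
Qed.

HB.instance Definition _ (R : comNzRingType) (V : lmodType R)
  (S : submodClosed V) :=
  GRing.isZmodClosed.Build V (zmod_of_submod S) (zmod_of_submod_closed S).

Definition quotmod (R : comNzRingType) (V : lmodType R) (S : submodClosed V) :=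
  Quotient.quot (zmod_of_submod S).

HB.instance Definition _ (R : comNzRingType) (V : lmodType R)
  (S : submodClosed V) := GRing.Zmodule.on (quotmod S).

Section QuotientModule.
Variables (R : comNzRingType) (V : lmodType R) (S : submodClosed V).

Definition quot_pi (x : V) : quotmod S :=
  \pi_(Quotient.quot (zmod_of_submod S)) x.
Definition quot_repr (q : quotmod S) : V :=
  repr (q : Quotient.quot (zmod_of_submod S)).

Lemma quot_reprK : cancel quot_repr quot_pi.
Proof. by move=> q; apply: reprK. Qed.

Lemma quot_piP x y : quot_pi x = quot_pi y <-> x - y \in S.
Proof.
have -> : (x - y \in S) = (quot_pi x == quot_pi y).
  exact: (Quotient.idealrBE (zmod_of_submod S) x y).
by split=> [->|/eqP].
Qed.

Fact quot_pi_zmod : zmod_morphism quot_pi.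
Proof.
by move=> x y; exact: (pi_is_zmod_morphism (Quotient.quot (zmod_of_submod S))).
Qed.

HB.instance Definition _ :=
  GRing.isZmodMorphism.Build V (quotmod S) quot_pi quot_pi_zmod.

Definition quot_scale (a : R) (q : quotmod S) : quotmod S :=
  quot_pi (a *: quot_repr q).

Fact quot_piZ a x : quot_scale a (quot_pi x) = quot_pi (a *: x).
Proof.
apply/quot_piP; rewrite -scalerBr; apply: rpredZ.
by apply/quot_piP; rewrite quot_reprK.
Qed.

Fact quot_scaleA a b q : quot_scale a (quot_scale b q) = quot_scale (a * b) q.
Proof. by rewrite -[q]quot_reprK !quot_piZ scalerA. Qed.

Fact quot_scale1 : left_id 1 quot_scale.
Proof. by move=> q; rewrite -[q]quot_reprK quot_piZ scale1r. Qed.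

Fact quot_scaleDr : right_distributive quot_scale +%R.
Proof.
move=> a p q; rewrite -[p]quot_reprK -[q]quot_reprK -raddfD !quot_piZ.
by rewrite scalerDr raddfD.
Qed.

Fact quot_scaleDl q : {morph quot_scale^~ q : a b / a + b}.
Proof.
by move=> a b /=; rewrite -[q]quot_reprK !quot_piZ scalerDl raddfD.
Qed.

HB.instance Definition _ := GRing.Zmodule_isLmodule.Build R (quotmod S)
  quot_scaleA quot_scale1 quot_scaleDr quot_scaleDl.

Fact quot_pi_scalable : scalable quot_pi.
Proof. by move=> a x; rewrite -quot_piZ. Qed.

HB.instance Definition _ :=
  GRing.isScalable.Build R V (quotmod S) *:%R quot_pi quot_pi_scalable.

End QuotientModule.

Section KernelImage.
Variables (R : comNzRingType) (V W : lmodType R) (f : {linear V -> W}).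

Definition kernel : {pred V} := [pred x | f x == 0].

Fact kernel_closed : submod_closed kernel.
Proof.
split=> [|a x y]; rewrite !inE ?linear0 // => /eqP fx0 /eqP fy0.
by rewrite linearP fx0 fy0 scaler0 addr0.
Qed.

HB.instance Definition _ := GRing.isSubmodClosed.Build R V kernel kernel_closed.

(* image of f, as a submodule of the submodule S of W *)
Definition image_in (S : submodClosed W) : {pred submodule S} :=
  [pred y | `[< exists x, f x = \val y >]].

Fact image_in_closed S : submod_closed (@image_in S).
Proof.
split=> [|a y z]; rewrite !inE; first by apply/asboolP; exists 0; rewrite !raddf0.
move=> /asboolP[x fx] /asboolP[t ft]; apply/asboolP; exists (a *: x + t).
by rewrite !linearP fx ft.
Qed.

HB.instance Definition _ S :=
  GRing.isSubmodClosed.Build R (submodule S) (@image_in S) (image_in_closed S).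

Definition image_of : {pred W} := [pred y | `[< exists x, f x = y >]].

Fact image_of_closed : submod_closed image_of.
Proof.
split=> [|a y z]; rewrite !inE; first by apply/asboolP; exists 0; rewrite raddf0.
move=> /asboolP[x fx] /asboolP[t ft]; apply/asboolP; exists (a *: x + t).
by rewrite linearP fx ft.
Qed.

HB.instance Definition _ :=
  GRing.isSubmodClosed.Build R W image_of image_of_closed.

End KernelImage.

Arguments image_in {R V W} f S.

Section Span.
Variables (R : comNzRingType) (V : lmodType R) (G : V -> Prop).

Definition span : {pred V} := [pred x | `[< forall S : submodClosed V,
  (forall g, G g -> g \in S) -> x \in S >]].

Fact span_closed : submod_closed span.
Proof.
split=> [|a x y]; rewrite !inE; first by apply/asboolP => S _; exact: rpred0.
move=> /asboolP Gx /asboolP Gy; apply/asboolP => S GS.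
by rewrite rpredD ?rpredZ ?Gx ?Gy.
Qed.

HB.instance Definition _ := GRing.isSubmodClosed.Build R V span span_closed.

Lemma mem_span x : G x -> x \in span.
Proof. by move=> Gx; rewrite inE; apply/asboolP => S; apply. Qed.

End Span.

(* {malg R[K]} is the free R-module on K, with basis the << k >>.             *)

Section FreeLift.
Variables (R : comNzRingType) (K : choiceType) (V : lmodType R) (h : K -> V).

Definition free_lift (g : {malg R[K]}) : V := \sum_(k <- msupp g) g@_k *: h k.

Lemma free_liftEw (E : {fset K}) g : (msupp g `<=` E)%fset ->
  free_lift g = \sum_(k <- E) g@_k *: h k.
Proof.
move=> le; rewrite /free_lift (big_fset_incl _ le) => //= x xd /mcoeff_outdom ->.
by rewrite scale0r.
Qed.

Fact free_lift_linear : linear free_lift.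
Proof.
move=> a g1 g2; pose E := (msupp g1 `|` msupp g2)%fset.
have E1 : (msupp g1 `<=` E)%fset by exact: fsubsetUl.
have E2 : (msupp g2 `<=` E)%fset by exact: fsubsetUr.
have E3 : (msupp (a *: g1 + g2) `<=` E)%fset.
  apply: fsubset_trans (msuppD_le _ _) _.
  by rewrite fsubUset E2 (fsubset_trans (msuppZ_le _ _) E1).
rewrite (free_liftEw E1) (free_liftEw E2) (free_liftEw E3).
rewrite scaler_sumr -big_split /=; apply: eq_bigr => k _.
by rewrite mcoeffD mcoeffZ scalerDl scalerA.
Qed.

HB.instance Definition _ :=
  GRing.isLinear.Build R {malg R[K]} V *:%R free_lift free_lift_linear.

Lemma free_liftU k : free_lift << k >> = h k.
Proof. by rewrite (free_liftEw msuppU_le) big_seq_fset1 mcoeffUU scale1r. Qed.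

End FreeLift.

Lemma free_liftP (R : comNzRingType) (K : choiceType) (V : lmodType R)
  (f : {linear {malg R[K]} -> V}) g : f g = free_lift (fun k => f << k >>) g.
Proof.
rewrite {1}[g]monalgE raddf_sum /=; apply: eq_bigr => k _.
rewrite -linearZ /=; congr (f _).
by apply/malgP => j; rewrite mcoeffZ !mcoeffU mulrnAr mulr1.
Qed.

Section Tensor.
Variables (R : comNzRingType) (A M : lmodType R).

Local Notation free := {malg R[(A * M)%type]}.
Local Notation e t m := (<< (t, m) >> : free).

Definition tensor_rel (g : free) : Prop :=
  (exists (a : R) (t t' : A) (m : M),
      g = e (a *: t + t') m - (a *: e t m + e t' m)) \/
  (exists (a : R) (t : A) (m m' : M),
      g = e t (a *: m + m') - (a *: e t m + e t m')).

Definition tensor : lmodType R := quotmod (span tensor_rel).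

Definition tens (t : A) (m : M) : tensor := quot_pi (span tensor_rel) (e t m).

Lemma tens_linearl m : linear (tens^~ m).
Proof.
move=> a t t'; rewrite -linearP; apply/quot_piP/mem_span; left.
by exists a, t, t', m.
Qed.

Lemma tens_linearr t : linear (tens t).
Proof.
move=> a m m'; rewrite -linearP; apply/quot_piP/mem_span; right.
by exists a, t, m, m'.
Qed.

Section Lift.
Variables (W : lmodType R) (b : A -> M -> W).
Hypotheses (b_linl : forall m, linear (b^~ m)) (b_linr : forall t, linear (b t)).

Definition tensor_lift (q : tensor) : W :=
  free_lift (fun p => b p.1 p.2) (quot_repr q).

Fact tensor_lift_pi g :
  tensor_lift (quot_pi _ g) = free_lift (fun p => b p.1 p.2) g.
Proof.
have: quot_repr (quot_pi (span tensor_rel) g) - g \in span tensor_rel.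
  by apply/quot_piP; rewrite quot_reprK.
rewrite inE => /asboolP spanP; apply/eqP; rewrite -subr_eq0 -raddfB /=.
apply: (spanP (kernel (free_lift (fun p : A * M => b p.1 p.2)))) => {spanP}g'.
by case=> [[a [t [t' [m ->]]]]|[a [t [m [m' ->]]]]];
  rewrite inE raddfB /= linearP /= !free_liftU /=;
  [have /= -> := b_linl m | have /= -> := b_linr t]; rewrite subrr.
Qed.

Fact tensor_lift_linear : linear tensor_lift.
Proof.
move=> a p q; rewrite -[p]quot_reprK -[q]quot_reprK -linearP.
by rewrite !tensor_lift_pi linearP.
Qed.

Lemma tensor_lift_tens t m : tensor_lift (tens t m) = b t m.
Proof. by rewrite tensor_lift_pi free_liftU. Qed.

End Lift.

Lemma tensor_ext (W : lmodType R) (f g : {linear tensor -> W}) :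
  (forall t m, f (tens t m) = g (tens t m)) -> f =1 g.
Proof.
move=> fg q; rewrite -[q]quot_reprK.
rewrite -/((f \o quot_pi _) _) free_liftP -/((g \o quot_pi _) _) [RHS]free_liftP.
by apply: eq_bigr => -[t m] _ /=; congr (_ *: _); apply: fg.
Qed.

End Tensor.

Section TensorMap.
Variables (R : comNzRingType) (A B : lmodType R) (f : {linear A -> B}).
Variable M : lmodType R.

(* f (x) id_M *)
Definition tensor_map (q : tensor A M) : tensor B M :=
  tensor_lift (fun t m => tens (f t) m) q.

Fact tensor_map_linear : linear tensor_map.
Proof.
apply: tensor_lift_linear => [m a t t'|t]; last exact: tens_linearr.
by rewrite linearP tens_linearl.
Qed.

HB.instance Definition _ := GRing.isLinear.Build R (tensor A M) (tensor B M)
  *:%R tensor_map tensor_map_linear.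

Lemma tensor_map_tens t m : tensor_map (tens t m) = tens (f t) m.
Proof.
apply: tensor_lift_tens => [{}m a {}t t'|{}t]; last exact: tens_linearr.
by rewrite linearP tens_linearl.
Qed.

End TensorMap.

Arguments tensor_map {R A B} f M q : rename.

Section Resolution.
Variables (R : comNzRingType) (T : lmodType R).

Definition ev (V : lmodType R) : {linear {malg R[V]} -> V} := free_lift id.

(* The canonical free resolution of T: P_n is the free module on the          *)
(* underlying set of the n-th syzygy syz n, where syz 0 = T and syz n.+1 is   *)
(* the kernel of P_n -> syz n; the differential is P_n.+1 -> syz n.+1 <= P_n. *)
Fixpoint syz (n : nat) : lmodType R :=
  if n is m.+1 then submodule (kernel (ev (syz m))) else T.

Definition res (n : nat) : lmodType R := {malg R[syz n]}.

Definition res_diff (n : nat) : {linear res n.+1 -> res n} :=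
  (\val : {linear submodule (kernel (ev (syz n))) -> res n}) \o ev (syz n.+1).

Lemma ev_surj (V : lmodType R) (x : V) : exists g, ev V g = x.
Proof. by exists << x >>; apply: free_liftU. Qed.

Lemma res_exact0 (x : res 0) : ev T x = 0 <-> exists y, res_diff 0 y = x.
Proof.
split=> [x0|[y <-]]; last by have /eqP := valP (ev (syz 1) y).
have xK : x \in kernel (ev (syz 0)) by rewrite inE; apply/eqP.
by have [y yE] := ev_surj (Submodule xK : syz 1); exists y; rewrite /= yE.
Qed.

Lemma res_exact n (x : res n.+1) :
  res_diff n x = 0 <-> exists y, res_diff n.+1 y = x.
Proof.
split=> [x0|[y <-]]; last first.
  have /eqP ev0 : ev (syz n.+1) (res_diff n.+1 y) == 0 := valP (ev (syz n.+2) y).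
  by rewrite [LHS](congr1 val ev0) raddf0.
have xK : x \in kernel (ev (syz n.+1)).
  by rewrite inE; apply/eqP/val_inj; rewrite raddf0.
by have [y yE] := ev_surj (Submodule xK : syz n.+2); exists y; rewrite /= yE.
Qed.

End Resolution.

(* Homology at B of A -f-> B -g-> C. *)
Definition homology (R : comNzRingType) (A B C : lmodType R)
  (f : {linear A -> B}) (g : {linear B -> C}) : lmodType R :=
  quotmod (image_in f (kernel g)).

(* Tor_n^R(T, M) = H_n(P (x) M), with P the canonical free resolution of T;   *)
(* in degree 0 the complex P (x) M is continued by 0.                         *)
Definition Tor (R : comNzRingType) (n : nat) (T M : lmodType R) : lmodType R :=
  if n is m.+1
  then homology (tensor_map (res_diff T m.+1) M) (tensor_map (res_diff T m) M)
  else quotmod (image_of (tensor_map (res_diff T 0) M)).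

Section Ideals.
Variable R : comNzRingType.

(* An ideal of R, possibly R itself, is a submodule of R^o; the library's     *)
(* idealr structure would only cover proper ideals.                           *)
Definition ideal := submodClosed R^o.

Definition nilpotent (x : R) : Prop := exists n : nat, x ^+ n = 0.

Definition nilrad : {pred R} := [pred x | `[< nilpotent x >]].

Definition zero_div : {pred R} := [pred x | `[< exists2 y : R, y != 0 & x * y = 0 >]].

Definition NP_ring : Prop := idealr_closed nilrad /\ prime_idealr_closed nilrad.

Definition ZN_ring : Prop := zero_div =i nilrad.

Definition nonnil (I : ideal) : Prop := exists2 x : R, x \in I & x \notin nilrad.

Definition fin_gen (I : ideal) : Prop :=
  exists (n : nat) (g : 'I_n -> R), forall x : R,
    x \in I <-> exists c : 'I_n -> R, x = \sum_(i < n) c i * g i.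

Section GV.
Variable J : ideal.

Definition gv_map (r : R) (x : submodule J) : R^o := r * \val x.

Fact gv_map_linear r : linear (gv_map r).
Proof.
by move=> a x y; rewrite /gv_map linearP mulrDr; congr (_ + _); exact: mulrCA.
Qed.

HB.instance Definition _ r :=
  GRing.isLinear.Build R (submodule J) R^o *:%R (gv_map r) (gv_map_linear r).

Definition gv_hom (r : R) : {linear submodule J -> R^o} := gv_map r.

(* gv_hom is R-linear for the pointwise structure on Hom_R(J, R), which is    *)
(* the type {linear submodule J -> R^o}, so it is an isomorphism exactly when *)
(* it is bijective.                                                           *)
Definition GV_ideal : Prop := fin_gen J /\ bijective gv_hom.

End GV.

Definition phi_torsion (T : lmodType R) : Prop :=
  forall x : T, exists2 I : ideal, nonnil I & forall a : R, a \in I -> a *: x = 0.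

Definition GV_torsion (M : lmodType R) : Prop :=
  forall x : M, exists2 J : ideal, GV_ideal J & forall a : R, a \in J -> a *: x = 0.

Definition phi_w_flat (M : lmodType R) : Prop :=
  forall T : lmodType R, phi_torsion T -> GV_torsion (Tor 1 T M).

Definition strongly_phi_w_flat (M : lmodType R) : Prop :=
  forall T : lmodType R, phi_torsion T ->
    forall n : nat, (1 <= n)%N -> GV_torsion (Tor n T M).

End Ideals.

(* Main.v *)
Require Import Defs.
From HB Require Import structures.
From mathcomp Require Import all_boot all_algebra.
From mathcomp Require Import finmap.
From mathcomp.multinomials Require Import monalg.
From mathcomp Require Import boolp.

(** Only phi-w-flat implies strongly phi-w-flat has content, and it follows by
dimension shifting inside the class of phi-torsion modules.  The kernel of a
free module mapping onto a phi-torsion module T is usually not phi-torsion, so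
the shift uses a different cover.  Since Nil(R) is prime, T is phi-torsion
exactly when each x in T is killed by some non-nilpotent s x
([phi_torsionP]), and since Z(R) = Nil(R) each s x is regular.  Let L be the
free module on the set T, and let sigma be the endomorphism of L that
multiplies the basis vector x by s x.  Then sigma is injective, so
F = L / sigma(L), the direct sum of the R / (s x), is a phi-torsion module of
projective dimension at most 1 that maps onto T.  Its kernel K over T is again
phi-torsion, by primality of Nil(R) ([ann_syz_torsion]).

As Tor_m(F, M) = 0 for m >= 2, the connecting map from Tor_{n+2}(T, M) to
Tor_{n+1}(K, M) is injective, and Tor_{n+2}(T, M) is GV-torsion as soon as
Tor_{n+1}(K, M) is ([Tor_shift]).  Induction on n, starting from Tor_1 and
letting T vary, gives the theorem.

The long exact sequence is replaced by an explicit resolution.  If Q is the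
canonical free resolution of K, the mapping cone of a lift of K -> F to
resolutions is a projective resolution of T
  ... -> Q_2 -> Q_1 -> L (+) Q_0 -> L -> T -> 0
([cone_projective], [cone_exact]), which agrees with Q, shifted by one, from
Q_1 on.  The comparison theorem ([chain_lift], [chain_homotopy]) provides a
homotopy equivalence between it and the canonical resolution of T, hence an
embedding on homology after tensoring with M ([GV_torsion_homology]). *)

Set Implicit Arguments.
Unset Strict Implicit.
Unset Printing Implicit Defensive.

Import GRing.Theory.

Local Open Scope ring_scope.

(** * Comparison of augmented complexes *)

(** Complexes are indexed so that the augmentation module sits in degree 0:
exactness in degree 0 is then surjectivity of the augmentation, and the
comparison theorem needs no separate base case. *)
Section Comparison.
Variable R : comNzRingType.

Definition projective (V : lmodType R) : Prop :=
  forall (X B : lmodType R) (g : {linear X -> B}) (f : {linear V -> B}),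
    (forall v, exists x, g x = f v) ->
    exists h : {linear V -> X}, forall v, g (h v) = f v.

Lemma projective_free (K : choiceType) : projective {malg R[K]}.
Proof.
move=> X B g f gf.
have [h hP] := choice (fun k => gf << k >>).
exists (free_lift h) => v.
rewrite -/((g \o free_lift h) v) free_liftP [RHS]free_liftP.
by apply: eq_bigr => k _ /=; rewrite free_liftU hP.
Qed.

Lemma projective_prod (V W : lmodType R) :
  projective V -> projective W -> projective (V * W)%type.
Proof.
move=> pV pW X B g f gf.
pose iV (v : V) : V * W := (v, 0).
pose iW (w : W) : V * W := (0, w).
have iV_lin : linear iV.
  by move=> a x y; congr (_, _); rewrite /= scaler0 addr0.
have iW_lin : linear iW.
  by move=> a x y; congr (_, _); rewrite /= scaler0 addr0.
pose liV : {linear V -> (V * W)%type} :=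
  HB.pack iV (GRing.isLinear.Build R V (V * W)%type *:%R iV iV_lin).
pose liW : {linear W -> (V * W)%type} :=
  HB.pack iW (GRing.isLinear.Build R W (V * W)%type *:%R iW iW_lin).
have [hV hVP] := pV _ _ g (f \o liV) (fun v => gf (iV v)).
have [hW hWP] := pW _ _ g (f \o liW) (fun w => gf (iW w)).
exists ((hV \o fst) \+ (hW \o snd)) => -[v w] /=.
rewrite raddfD /= hVP hWP /= -raddfD; congr (f _).
by congr (_, _); rewrite /= ?addr0 ?add0r.
Qed.

(** The invariant P is what makes the next step possible; the lemmas below use
it to carry the cycle condition that the next lift requires. *)
Lemma dependent_choice (A : nat -> Type) (P : forall n, A n -> Prop)
    (Q : forall n, A n -> A n.+1 -> Prop) (a : A 0) :
  P 0 a -> (forall n x, P n x -> exists2 y, P n.+1 y & Q n x y) ->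
  exists2 u : forall n, A n, u 0 = a & forall n, Q n (u n) (u n.+1).
Proof.
move=> Pa step.
pose next n (x : {x : A n | P n x}) :=
  let: exist2 y Py _ := cid2 (step n (sval x) (svalP x)) in
  exist (P n.+1) y Py.
pose u := nat_rect (fun n => {x : A n | P n x}) (exist _ a Pa) next.
exists (fun n => sval (u n)) => // n.
by rewrite /= /next; case: cid2.
Qed.

Variables (X Y : nat -> lmodType R).
Variables (dX : forall n, {linear X n.+1 -> X n}).
Variables (dY : forall n, {linear Y n.+1 -> Y n}).
Hypothesis X_proj : forall n, projective (X n.+1).
Hypothesis X_complex : forall n x, dX n (dX n.+1 x) = 0.
Hypothesis Y_exact : forall n y, dY n y = 0 -> exists z, dY n.+1 z = y.

(** Each f n.+1 lifts f n \o dX n through dY n.  This is possible because f n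
maps boundaries to boundaries: it maps them to cycles, and Y is exact. *)
Lemma chain_lift (f0 : {linear X 0 -> Y 0}) :
  (forall y, exists z, dY 0 z = y) ->
  exists2 f : forall n, {linear X n -> Y n},
    f 0 = f0 & forall n x, dY n (f n.+1 x) = f n (dX n x).
Proof.
move=> Y_surj.
apply: (@dependent_choice (fun n => {linear X n -> Y n})
  (fun n f => forall x, exists y, dY n y = f (dX n x))
  (fun n f f' => forall x, dY n (f' x) = f (dX n x))) => [x|n f fP].
  exact: Y_surj.
have [g gP] := X_proj (f := f \o dX n) fP.
by exists g => // x; apply: Y_exact; rewrite gP /= X_complex raddf0.
Qed.

(** The homotopy starts at 0 in degree 0, and s n.+1 lifts
f n.+1 - s n \o dX n, whose values are cycles by the homotopy identity in the
previous degree. *)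
Lemma chain_homotopy (f : forall n, {linear X n -> Y n}) :
  (forall n x, dY n (f n.+1 x) = f n (dX n x)) -> (forall x, f 0 x = 0) ->
  exists s : forall n, {linear X n -> Y n.+1},
    forall n x, f n.+1 x = dY n.+1 (s n.+1 x) + s n (dX n x).
Proof.
move=> fd f0.
have [||s _ sP] := @dependent_choice (fun n => {linear X n -> Y n.+1})
  (fun n s => forall x, dY n (f n.+1 x - s (dX n x)) = 0)
  (fun n s s' => forall x, dY n.+1 (s' x) = f n.+1 x - s (dX n x)) \0.
- by move=> x; rewrite subr0 fd f0.
- move=> n s sP.
  have [g gP] := X_proj (f := f n.+1 \- (s \o dX n)) (fun x => Y_exact (sP x)).
  exists g => // x; rewrite raddfB /= gP /= X_complex raddf0 subr0 fd.
  exact: subrr.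
by exists s => n x; rewrite sP subrK.
Qed.

End Comparison.

(** * Tensor products of maps *)

Section TensorFunctor.
Variables (R : comNzRingType) (M : lmodType R).

Lemma tensor_map_square (A B B' C : lmodType R) (f : {linear A -> B})
    (g : {linear B -> C}) (f' : {linear A -> B'}) (g' : {linear B' -> C}) :
  (forall x, g (f x) = g' (f' x)) ->
  forall z, tensor_map g M (tensor_map f M z)
            = tensor_map g' M (tensor_map f' M z).
Proof.
move=> gf; apply: (@tensor_ext _ _ _ _ (tensor_map g M \o tensor_map f M)
  (tensor_map g' M \o tensor_map f' M)) => t m /=.
by rewrite !tensor_map_tens gf.
Qed.

Lemma tensor_map_homotopy (A B B' C : lmodType R)
    (g : {linear A -> B}) (h : {linear B -> A})
    (s : {linear A -> B'}) (d : {linear B' -> A})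
    (d' : {linear A -> C}) (s' : {linear C -> A}) :
  (forall x, x - h (g x) = d (s x) + s' (d' x)) ->
  forall z, z - tensor_map h M (tensor_map g M z)
    = tensor_map d M (tensor_map s M z) + tensor_map s' M (tensor_map d' M z).
Proof.
move=> E; apply: (@tensor_ext _ _ _ _
  (idfun \- (tensor_map h M \o tensor_map g M))
  ((tensor_map d M \o tensor_map s M) \+ (tensor_map s' M \o tensor_map d' M))).
move=> t m /=; rewrite !tensor_map_tens.
pose tm : {linear A -> tensor A M} :=
  HB.pack ((@tens R A M)^~ m) (GRing.isLinear.Build _ _ _ _ ((@tens R A M)^~ m) (tens_linearl m)).
by rewrite -[LHS](raddfB tm) -[RHS](raddfD tm) E.
Qed.

End TensorFunctor.

(** * Non-nilpotent annihilators and diagonal maps of free modules *)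

Section TorsionCover.
Variable R : comNzRingType.

(** One non-nilpotent annihilator of x suffices, since the annihilator of x is
an ideal and is nonnil as soon as it contains such an element. *)
Lemma phi_torsionP (T : lmodType R) :
  phi_torsion T <-> forall x : T, exists2 s : R, s \notin @nilrad R & s *: x = 0.
Proof.
split=> H x; have := H x.
  by case=> I [s sI sN] Ix; exists s => //; apply: Ix.
case=> s sN sx.
pose act (a : R^o) : T := (a : R) *: x.
have act_lin : linear act by move=> a b c; rewrite /act scalerDl -scalerA.
pose lact : {linear R^o -> T} :=
  HB.pack act (GRing.isLinear.Build R R^o T *:%R act act_lin).
exists (kernel lact : ideal R); first by exists s => //; rewrite inE /= /act sx.
by move=> a; rewrite inE => /eqP.
Qed.

Lemma nonnil_prod (I : Type) (r : seq I) (F : I -> R) :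
  NP_ring R -> (forall i, F i \notin @nilrad R) ->
  \prod_(i <- r) F i \notin @nilrad R.
Proof.
case=> -[_ n1 _] prm Fn.
apply: (big_ind (fun x => x \notin @nilrad R)) => // x y xn yn.
by apply/negP => /prm /orP[]; apply/negP.
Qed.

Lemma nonnil_regular (s y : R) :
  ZN_ring R -> s \notin @nilrad R -> s * y = 0 -> y = 0.
Proof.
move=> ZN sN sy; apply/eqP; apply: contraNT sN => y0.
by rewrite -ZN inE; apply/asboolP; exists y.
Qed.

Section Scaling.
Variables (K : choiceType) (s : K -> R).

Definition scaling : {linear {malg R[K]} -> {malg R[K]}} :=
  free_lift (fun k => s k *: << k >>).

Lemma mcoeff_scaling g k : (scaling g)@_k = s k * g@_k.
Proof.
pose E := (k |` msupp g)%fset.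
have gE : (msupp g `<=` E)%fset by apply: fsubsetUr.
rewrite /scaling /= (free_liftEw _ gE) raddf_sum /=.
rewrite (big_fsetD1 k) ?fset1U1 //= big_seq_cond big1 ?addr0.
  by rewrite !mcoeffZ mcoeffUU mulr1 mulrC.
move=> i; rewrite andbT !inE => /andP[/negPf ik _].
by rewrite !mcoeffZ mcoeffU ik !mulr0.
Qed.

Lemma scaling_inj : (forall k y, s k * y = 0 -> y = 0) ->
  forall g, scaling g = 0 -> g = 0.
Proof.
move=> reg g sg; apply/malgP => k; rewrite mcoeff0; apply: (reg k).
by rewrite -mcoeff_scaling sg mcoeff0.
Qed.

(** The cokernel of the scaling map is the direct sum of the R / (s k), so the
class of g is killed by the product of the s k over the support of g. *)
Lemma scaling_prod g : exists l, scaling l = (\prod_(k <- msupp g) s k) *: g.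
Proof.
suff: (\prod_(k <- msupp g) s k) *: g \in image_of scaling.
  by rewrite inE => /asboolP.
rewrite {2}[g]monalgE scaler_sumr big_seq; apply: rpred_sum => k kg.
rewrite (big_fsetD1 k) //= inE; apply/asboolP.
exists (\prod_(i <- (msupp g `\ k)%fset) s i *: << g@_k *g k >>).
apply/malgP => j; rewrite mcoeff_scaling !mcoeffZ !mcoeffU.
by case: eqP => [->|_]; rewrite ?mulr0 // !mulrA.
Qed.

End Scaling.
End TorsionCover.

(** * Homology classes *)

Section HomologyClass.
Variables (R : comNzRingType) (A B C : lmodType R).
Variables (f : {linear A -> B}) (g : {linear B -> C}).

Definition hclass (y : submodule (kernel g)) : homology f g := quot_pi _ y.

Lemma hclass_surj (q : homology f g) : exists y, hclass y = q.
Proof. by exists (quot_repr q); apply: quot_reprK. Qed.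

Lemma hclass_eq0 y : hclass y = 0 <-> exists x, f x = \val y.
Proof.
rewrite -(raddf0 (quot_pi _)); split=> [/quot_piP|[x fx]].
  by rewrite subr0 inE => /asboolP.
by apply/quot_piP; rewrite subr0 inE; apply/asboolP; exists x.
Qed.

Lemma hclass_scale_eq0 a y : a *: hclass y = 0 <-> exists x, f x = a *: \val y.
Proof. by rewrite -linearZ -[X in _ <-> exists x, _ = X]linearZ; apply: hclass_eq0. Qed.

End HomologyClass.

(** Up to homotopy, the complex of the A's is a retract of that of the B's near
the middle degree: g induces a map on homology with left inverse induced by h.
An ideal killing the class of g z therefore kills the class of z. *)
Lemma GV_torsion_homology (R : comNzRingType) (A3 A2 A1 B3 B2 B1 : lmodType R)
    (d3 : {linear A3 -> A2}) (d2 : {linear A2 -> A1})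
    (e3 : {linear B3 -> B2}) (e2 : {linear B2 -> B1})
    (g : {linear A2 -> B2}) (g' : {linear A1 -> B1})
    (h : {linear B2 -> A2}) (h' : {linear B3 -> A3})
    (u : {linear A2 -> A3}) (u' : {linear A1 -> A2}) :
  (forall x, e2 (g x) = g' (d2 x)) -> (forall x, h (e3 x) = d3 (h' x)) ->
  (forall x, x - h (g x) = d3 (u x) + u' (d2 x)) ->
  GV_torsion (homology e3 e2) -> GV_torsion (homology d3 d2).
Proof.
move=> gP hP uP torE q; have [[z zK] <-] := hclass_surj q.
have z0 : d2 z = 0 by apply/eqP.
have gzK : g z \in kernel e2 by rewrite inE gP z0 raddf0.
have [J JGV Jgz] := torE (hclass e3 (Submodule gzK)).
exists J => // a /Jgz /hclass_scale_eq0[y yE]; apply/hclass_scale_eq0.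
exists (h' y + a *: u z).
rewrite raddfD /= -hP yE !linearZ -scalerDr; congr (_ *: _).
by have := uP z; rewrite z0 raddf0 addr0 => <-; rewrite addrC subrK.
Qed.

(** * The cover of a phi-torsion module and its cone resolution *)

Section Shift.
Variables (R : comNzRingType) (T : lmodType R) (s : T -> R).
Hypothesis s_reg : forall x y, s x * y = 0 -> y = 0.
Hypothesis s_ann : forall x, s x *: x = 0.

Local Notation sigma := (scaling s).

(** The kernel K of F -> T, where F = L / sigma(L): it is ker(L -> T) / sigma(L),
that is, the homology at L of L -> L -> T. *)
Definition ann_syz : lmodType R := homology sigma (ev T).
Local Notation K := ann_syz.

Lemma ev_scaling l : ev T (sigma l) = 0.
Proof.
rewrite -/((ev T \o sigma) l) free_liftP /free_lift big1 // => k _ /=.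
by rewrite free_liftU linearZ /= free_liftU s_ann scaler0.
Qed.

Lemma ann_syz_torsion : NP_ring R -> (forall x, s x \notin @nilrad R) ->
  phi_torsion K.
Proof.
move=> NP sN; apply/phi_torsionP => q; rewrite -[q]quot_reprK.
set y := quot_repr q.
have [l lP] := scaling_prod s (\val y).
exists (\prod_(k <- msupp (\val y)) s k); first exact: nonnil_prod.
by apply/hclass_scale_eq0; exists l.
Qed.

(** A lift to L of the composite Q_0 -> K -> F. *)
Definition lift_ann_syz : {linear res K 0 -> {malg R[T]}} :=
  free_lift (fun k : K => \val (quot_repr k)).
Local Notation tau := lift_ann_syz.

Lemma lift_ann_syzP q : exists2 y : submodule (kernel (ev T)),
  \val y = tau q & hclass sigma y = ev K q.
Proof.
exists (free_lift (fun k : K => quot_repr k) q).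
  rewrite -/((\val \o free_lift _) q) [LHS]free_liftP [RHS]free_liftP.
  by apply: eq_bigr => k _ /=; rewrite !free_liftU.
rewrite /hclass -/((quot_pi _ \o free_lift _) q) [LHS]free_liftP [RHS]free_liftP.
by apply: eq_bigr => k _ /=; rewrite !free_liftU quot_reprK.
Qed.

Lemma ev_lift q : ev T (tau q) = 0.
Proof. by have [y <- _] := lift_ann_syzP q; apply/eqP/(valP y). Qed.

Lemma lift_eq0 q : ev K q = 0 <-> exists l, sigma l = tau q.
Proof.
by have [y <- <-] := lift_ann_syzP q; apply: hclass_eq0.
Qed.

(** Boundaries of Q vanish in K, so tau maps them into sigma(L); theta is the
degree 1 part of the chain map from Q to the resolution L -> L of F. *)
Lemma theta_exists : exists theta : {linear res K 1 -> {malg R[T]}},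
  forall q, sigma (theta q) = tau (res_diff K 0 q).
Proof.
have [q|h hP] := projective_free (g := sigma) (f := tau \o res_diff K 0).
  by apply/lift_eq0/res_exact0; exists q.
by exists h.
Qed.

Section Cone.
Variable theta : {linear res K 1 -> {malg R[T]}}.
Hypothesis thetaP : forall q, sigma (theta q) = tau (res_diff K 0 q).

(** The mapping cone of (tau, theta), augmented by T in degree 0. *)
Definition cone (n : nat) : lmodType R :=
  match n with
  | 0 => T
  | 1 => {malg R[T]}
  | 2 => ({malg R[T]} * res K 0)%type
  | m.+3 => res K m.+1
  end.

(** The sign makes the composite with sigma + tau vanish. *)
Definition cone_diff2 (q : res K 1) : {malg R[T]} * res K 0 :=
  (- theta q, res_diff K 0 q).

Fact cone_diff2_linear : linear cone_diff2.
Proof.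
by move=> a x y; rewrite /cone_diff2 !linearP; congr (_, _); rewrite opprD scalerN.
Qed.

HB.instance Definition _ := GRing.isLinear.Build R (res K 1)
  ({malg R[T]} * res K 0)%type *:%R cone_diff2 cone_diff2_linear.

Definition cone_diff (n : nat) : {linear cone n.+1 -> cone n} :=
  match n with
  | 0 => ev T
  | 1 => (sigma \o fst) \+ (tau \o snd)
  | 2 => cone_diff2
  | m.+3 => res_diff K m.+1
  end.

Lemma cone_projective n : projective (cone n.+1).
Proof.
case: n => [|[|n]]; try exact: projective_free.
by apply: projective_prod; apply: projective_free.
Qed.

Lemma cone_complex n x : cone_diff n (cone_diff n.+1 x) = 0.
Proof.
case: n x => [|[|[|n]]] x.
- by rewrite /= raddfD /= ev_scaling ev_lift addr0.
- by rewrite /= raddfN /= thetaP addNr.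
- rewrite /=; have d0 : res_diff K 0 (res_diff K 1 x) = 0 by apply/res_exact; exists x.
  rewrite /cone_diff2 d0 (scaling_inj s_reg (g := theta _)) ?oppr0 //.
  by rewrite thetaP d0 raddf0.
- by apply/res_exact; exists x.
Qed.

(** In degree 2 a cycle (l, q) satisfies tau q = - sigma l, so q vanishes in K
and is a boundary d q'; injectivity of sigma then forces l = - theta q'. *)
Lemma cone_exact n x : cone_diff n x = 0 -> exists y, cone_diff n.+1 y = x.
Proof.
case: n x => [|[|[|n]]] x.
- move=> /= x0.
  have xK : x \in kernel (ev T) by rewrite inE; apply/eqP.
  have [q qE] := ev_surj (quot_pi _ (Submodule xK) : K).
  have [y yE] := lift_ann_syzP q; rewrite qE => /esym/quot_piP.
  rewrite inE => /asboolP[l]; rewrite raddfB /= yE => lE.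
  by exists (l, q); rewrite /= lE subrK.
- case: x => l q /= lq0.
  have /lift_eq0 q0 : exists l', sigma l' = tau q.
    by exists (- l); rewrite raddfN /=; apply/eqP; rewrite eq_sym -addr_eq0 addrC lq0.
  have [q' q'E] := (res_exact0 q).1 q0.
  exists q'; rewrite /cone_diff2 q'E; congr (_, _).
  apply/eqP; rewrite eq_sym -addr_eq0; apply/eqP/(scaling_inj s_reg).
  by rewrite raddfD /= thetaP q'E.
- by case=> _; exact: (res_exact x).1.
- exact: (res_exact x).1.
Qed.

End Cone.

Definition aug_res (n : nat) : lmodType R :=
  if n is m.+1 then res T m else T.

Definition aug_res_diff (n : nat) : {linear aug_res n.+1 -> aug_res n} :=
  if n is m.+1 then res_diff T m else ev T.

Lemma aug_res_projective n : projective (aug_res n.+1).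
Proof. exact: projective_free. Qed.

Lemma aug_res_exact n x : aug_res_diff n x = 0 <-> exists y, aug_res_diff n.+1 y = x.
Proof. by case: n x => [|n] x; [apply: res_exact0 | apply: res_exact]. Qed.

Lemma aug_res_complex n x : aug_res_diff n (aug_res_diff n.+1 x) = 0.
Proof. by apply/aug_res_exact; exists x. Qed.

(** The comparison maps between the canonical resolution of T and the cone, in
the degrees where the cone is the resolution of K. *)
Lemma shift_maps (n : nat) :
  exists (g : {linear res T n.+2 -> res K n.+1})
         (p : {linear res T n.+1 -> res K n})
         (h : {linear res K n.+1 -> res T n.+2})
         (h' : {linear res K n.+2 -> res T n.+3})
         (u : {linear res T n.+2 -> res T n.+3})
         (u' : {linear res T n.+1 -> res T n.+2}),
  [/\ forall x, res_diff K n (g x) = p (res_diff T n.+1 x),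
      forall x, h (res_diff K n.+1 x) = res_diff T n.+2 (h' x) &
      forall x, x - h (g x) = res_diff T n.+2 (u x) + u' (res_diff T n.+1 x)].
Proof.
have [theta thetaP] := theta_exists.
have Tsurj : forall y, exists z, aug_res_diff 0 z = y by apply: ev_surj.
have Csurj : forall y, exists z, cone_diff theta 0 z = y by apply: ev_surj.
have [g g0 gP] := chain_lift aug_res_projective aug_res_complex
  (cone_exact thetaP) idfun Csurj.
have [h h0 hP] := chain_lift cone_projective (cone_complex thetaP)
  (fun n y => (aug_res_exact y).1) idfun Tsurj.
have [||u uP] := chain_homotopy aug_res_projective aug_res_complex
  (fun n y => (aug_res_exact y).1) (f := fun n => idfun \- (h n \o g n)).
- by move=> m x; rewrite raddfB /= hP gP.
- by move=> x; rewrite /= g0 h0 subrr.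
(* In degree 2 the cone is L (+) Q_0, and the differential out of Q_1 composed
with the second projection is that of Q; in higher degrees it is that of Q. *)
pose p : {linear res T n.+1 -> res K n} :=
  match n return {linear res T n.+1 -> cone n.+2} -> {linear res T n.+1 -> res K n} with
  | 0 => fun f => snd \o f
  | _ => id
  end (g n.+2).
exists (g n.+3), p, (h n.+3), (h n.+4), (u n.+3), (u n.+2); split=> x.
- have := gP n.+2 x; rewrite {}/p.
  by case: n x => [|n] x /= <-.
- exact/esym/(hP n.+3 x).
- exact: (uP n.+2 x).
Qed.

(** The comparison maps and homotopy are R-linear, so they survive tensoring
with M. *)
Lemma Tor_shift (M : lmodType R) (n : nat) :
  GV_torsion (Tor n.+1 K M) -> GV_torsion (Tor n.+2 T M).
Proof.
have [g [p [h [h' [u [u' [gP hP uP]]]]]]] := shift_maps n.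
exact: (GV_torsion_homology (tensor_map_square gP) (tensor_map_square hP)
  (tensor_map_homotopy uP)).
Qed.

End Shift.

Theorem theorem1p6 (R : comNzRingType) (M : lmodType R) :
  NP_ring R -> ZN_ring R -> phi_w_flat M <-> strongly_phi_w_flat M.
Proof.
move=> NP ZN; split=> [flat T Ttor n|flat T Ttor]; last exact: flat.
case: n => // n _; elim: n T Ttor => [|n IHn] T Ttor; first exact: flat.
have [s sN] := choice (fun x => (exists2P _ _).1 ((phi_torsionP T).1 Ttor x)).
apply: (@Tor_shift _ _ s) => [x y|x|].
- by apply: nonnil_regular => //; have [] := sN x.
- by have [] := sN x.
- by apply/IHn/ann_syz_torsion => // x; have [] := sN x.
Qed.
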